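(* Let $M\ge1$, $B\ge1$, $T\ge0$, $W$ be integers with $W\ge M(T+1)$, and write $B=bM+B'$ with $b\in\mathbb{N}_0$ and $B'\in\{0,\dots,M-1\}$. Then the capacity $C$ (largest achievable rate with delay $T$ macro-packets) of the channel $\mathcal{C}(N=1,B,W)$ with $M$ channel uses per source symbol is \[ C=\begin{cases}\frac{T}{T+b}, & B'\le \frac{b}{T+b}M,\ T\ge b,\\[2pt] \frac{M(T+b+1)-B}{M(T+b+1)}, & B'>\frac{b}{T+b}M,\ T>b,\\[2pt] \frac{M-B'}{M}, & B'>\frac{M}{2},\ T=b,\\[2pt] 0, & T<b.\end{cases} \]
   Context: Channel $\mathcal{C}(N,B,W)$: a packet erasure channel on the sequence of channel uses (in time order) such that in every sliding window of $W$ consecutive channel uses, the erased positions form either a single burst of consecutive erasures of length at most $B$, or at most $N$ erasures in arbitrary positions; with $N=1$ this means every window of length $W$ contains at most one burst of length at most $B$. Streaming code with unequal source–channel rates: source symbols $\mathbf{s}[i]\in\mathbb{F}_q^k$, $i\ge0$, arrive one per macro-packet; macro-packet $i$ consists of $M$ consecutive channel uses carrying $\mathbf{x}[i,j]=f_{i,j}(\mathbf{s}[0],\dots,\mathbf{s}[i])\in\mathbb{F}_q^n$, $j=1,\dots,M$ (channel use order $\mathbf{x}[0,1],\dots,\mathbf{x}[0,M],\mathbf{x}[1,1],\dots$). Outputs are $\mathbf{y}[i,j]=\mathbf{x}[i,j]$ or $\star$ (erasure); $\mathbf{Y}[i,:]=(\mathbf{y}[i,1],\dots,\mathbf{y}[i,M])$.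 The code has delay $T$ macro-packets if there are decoders with $\mathbf{s}[i]=g_i(\mathbf{Y}[0,:],\dots,\mathbf{Y}[i+T,:])$ for all $i$, all sources and all erasure patterns allowed by the channel. Its rate is $R=k/(Mn)$. A rate is achievable if such a code exists over some field size $q$; the capacity is the largest achievable rate.
   Formalization: The first case is stated only for T > 0: when T = b = 0 the expressions b/(T+b) and T/(T+b) are 0/0, so no capacity is claimed for T = b = 0 with B' ≤ M/2. *)

(* Defs.v *)
From HB Require Import structures.
From mathcomp Require Import all_boot all_order all_algebra.
Set Implicit Arguments. Unset Strict Implicit. Unset Printing Implicit Defensive.
Import Order.TTheory GRing.Theory Num.Theory.

(* Channel uses are numbered 0,1,2,... in time order; channel use (i, j)
   with i the macro-packet index and j : 'I_M (0-based, i.e. the paper's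
   j = j0+1) is channel use number i * M + j. An erasure pattern is a
   boolean predicate on channel-use numbers (true = erased). *)
Definition chan_idx (M i : nat) (j : 'I_M) : nat := (i * M + j)%N.

Definition nerasures (E : nat -> bool) (W t : nat) : nat :=
  (\sum_(t <= u < t + W) E u)%N.

Definition window_burst (E : nat -> bool) (W t : nat) : Prop :=
  forall u v w, (t <= u)%N -> (u <= v)%N -> (v <= w)%N -> (w < t + W)%N ->
    E u -> E w -> E v.

Definition admissible (N B W : nat) (E : nat -> bool) : Prop :=
  forall t : nat,
    (window_burst E W t /\ (nerasures E W t <= B)%N) \/
    (nerasures E W t <= N)%N.

Definition encoder (F : finFieldType) (k n M : nat) :=
  nat -> 'I_M -> (nat -> 'rV[F]_k) -> 'rV[F]_n.

Definition causal_enc (F : finFieldType) (k n M : nat) (f : encoder F k n M) : Prop :=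
  forall i j (s s' : nat -> 'rV[F]_k),
    (forall l, (l <= i)%N -> s l = s' l) -> f i j s = f i j s'.

Definition received (F : finFieldType) (k n M : nat) (f : encoder F k n M)
  (s : nat -> 'rV[F]_k) (E : nat -> bool) : nat -> 'I_M -> option 'rV[F]_n :=
  fun i j => if E (chan_idx i j) then None else Some (f i j s).

Definition decoder (F : finFieldType) (k n M : nat) :=
  nat -> (nat -> 'I_M -> option 'rV[F]_n) -> 'rV[F]_k.

Definition causal_dec (F : finFieldType) (k n M T : nat) (g : decoder F k n M) : Prop :=
  forall i (Y Y' : nat -> 'I_M -> option 'rV[F]_n),
    (forall l (j : 'I_M), (l <= i + T)%N -> Y l j = Y' l j) -> g i Y = g i Y'.

Definition streaming_code (F : finFieldType) (k n M T N B W : nat) : Prop :=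
  exists (f : encoder F k n M) (g : decoder F k n M),
    causal_enc f /\ causal_dec T g /\
    forall (s : nat -> 'rV[F]_k) (E : nat -> bool),
      admissible N B W E -> forall i, g i (received f s E) = s i.

Definition achievable (M T N B W : nat) (R : rat) : Prop :=
  exists (F : finFieldType) (k n : nat), (0 < n)%N /\
    R = (k%:R / (M * n)%:R)%R /\ streaming_code F k n M T N B W.

Definition is_capacity (M T N B W : nat) (C : rat) : Prop :=
  achievable M T N B W C /\
  forall R, achievable M T N B W R -> (R <= C)%R.

(* Main.v *)
Require Import Defs.
From HB Require Import structures.
From mathcomp Require Import all_boot all_order all_algebra.
From mathcomp Require Import boolp zify ring.
Import Order.TTheory GRing.Theory Num.Theory.
Local Open Scope ring_scope.

(** Converse.  Past source symbols can be re-encoded, so each decoding step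
    sees at most one burst; erasing the first [be] channel uses of every period
    of [T + de] macro-packets, where [be <= B] and [be <= de * M], still
    determines the whole source, and counting gives
    [k * (T + de) <= n * ((T + de) * M - be)].  Cases 3 and 4 only need one
    burst at time 0.

    Achievability.  A macro-packet is a row of [P = M * n] scalars: urgent source
    symbols [u] first, then source symbols [v], possibly some padding, and
    finally as many parities as there are [u]'s.  A parity is the sum of the [u]
    sent [T] macro-packets earlier and of a Cauchy combination
    [\sum_y v_y / (xi_z - xi_y)] of the recent [v]'s, where [xi] is injective on
    windows of [T + 1] macro-packets.  After a burst, the parities whose [u]-part
    is known outnumber the erased [v]'s, and Cauchy systems are nonsingular, so
    the [v]'s are recovered; then the parities of macro-packet [i + T] release
    the erased [u]'s of macro-packet [i].  The count works as soon as a burst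
    placed at the start of a macro-packet hits at most [T * U] positions of
    type [v] or parity. *)

(** * Cauchy systems *)

(** Clearing denominators turns the sum into values of a polynomial [Q] of degree below [size A]. It
    has at least [size A] roots, so it is zero, and its value at [x i] is [c i] times a nonzero
    product. *)
Lemma cauchy_kernel (F : fieldType) (I : eqType) (A : seq I) (x c : I -> F)
    (ys : seq F) :
    uniq [seq x i | i <- A] -> uniq ys -> (size A <= size ys)%N ->
    {in A & ys, forall i y, y != x i} ->
    {in ys, forall y, \sum_(i <- A) c i / (y - x i) = 0} ->
  {in A, forall i, c i = 0}.
Proof.
move=> uxA uys leAy xy0 sum0.
have uA := map_uniq uxA.
pose num i := \prod_(j <- rem i A) ('X - (x j)%:P).
pose Q := \sum_(i <- A) c i *: num i.
have szQ : (size Q <= size A)%N.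
  rewrite /Q big_seq; apply: (big_ind (fun q : {poly F} => size q <= size A)%N).
  - by rewrite size_poly0.
  - by move=> p q szp szq; rewrite (leq_trans (size_polyD _ _)) // geq_max szp.
  - move=> i iA; apply: leq_trans (size_scale_leq _ _) _.
    by rewrite size_prod_XsubC size_rem //; case: (A) iA.
have numE i : i \in A -> \prod_(j <- A) ('X - (x j)%:P) = ('X - (x i)%:P) * num i.
  by move=> iA; rewrite (perm_big _ (perm_to_rem iA)) big_cons.
(* Up to the factor [\prod_j (y - x j)], [Q.[y]] is the vanishing Cauchy sum. *)
have Q0 : Q = 0.
  apply: roots_geq_poly_eq0 (leq_trans szQ leAy) => //.
  apply/allP => y yys; rewrite rootE /Q horner_sum.
  set D := (\prod_(j <- A) ('X - (x j)%:P)).[y].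
  have -> : \sum_(i <- A) (c i *: num i).[y] = D * \sum_(i <- A) c i / (y - x i).
    rewrite mulr_sumr big_seq [RHS]big_seq; apply: eq_bigr => i iA.
    rewrite /D (numE i iA) hornerM hornerXsubC hornerZ.
    have : y - x i != 0 by rewrite subr_eq0 (xy0 i y).
    by move: (num i).[y] => z nz; field.
  by rewrite sum0 // mulr0.
move=> i iA; have : Q.[x i] = 0 by rewrite Q0 horner0.
rewrite /Q horner_sum (bigD1_seq i) //= big_seq_cond big1 ?addr0; last first.
  move=> j /andP[jA ji]; rewrite hornerZ /num horner_prod.
  rewrite (perm_big _ (perm_to_rem (_ : i \in rem j A))) /=; last first.
    by rewrite mem_rem_uniq // inE eq_sym ji.
  by rewrite big_cons hornerXsubC subrr mul0r mulr0.
rewrite hornerZ => /eqP; rewrite mulf_eq0 => /orP[/eqP //|].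
rewrite /num horner_prod prodf_seq_eq0 => /hasP[j].
rewrite mem_rem_uniq // inE => /andP[ji jA] /=; rewrite hornerXsubC subr_eq0.
move=> /eqP xij; case/eqP: ji.
have := uxA; rewrite -(nth_index i iA) -(nth_index i jA) in xij *.
move=> /(uniqP (x i)) inj; congr nth.
by apply: inj; rewrite ?inE ?size_map ?index_mem // !(nth_map i) ?index_mem.
Qed.

(** * Decoders and the erasure channel *)

(** Decoding need only be unambiguous: strong induction on [i] discharges the agreement on earlier
    symbols. *)
Lemma streaming_code_of_unique (F : finFieldType) (k n M T N B W : nat)
    (f : encoder F k n M) :
    causal_enc f ->
    (forall (s s' : nat -> 'rV[F]_k) E i, admissible N B W E ->
       (forall l, (l < i)%N -> s l = s' l) ->
       (forall l j, (l <= i + T)%N -> ~~ E (chan_idx l j) ->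
          f l j s = f l j s') -> s i = s' i) ->
  streaming_code F k n M T N B W.
Proof.
move=> cf uniq_f.
pose P i Y v := exists s E, [/\ admissible N B W E,
  forall l j, (l <= i + T)%N -> received f s E l j = Y l j & s i = v].
have PU s E s' E' i : admissible N B W E ->
    (forall l j, (l <= i + T)%N -> received f s E l j = received f s' E' l j) ->
    s i = s' i.
  move=> aE rE.
  have fE l j : (l <= i + T)%N -> ~~ E (chan_idx l j) -> f l j s = f l j s'.
    by move=> li /negbTE nE; have := rE l j li; rewrite /received nE; case: ifP => // _ [].
  elim/ltn_ind: i {rE} fE => i IH fE.
  apply: (uniq_f s s' E) => // l li; apply: IH => // l' j l'l; apply: fE; lia.
(* Any source compatible with the observations gives the right answer. *)
pose g i Y := odflt 0 [pick v | `[< P i Y v >]].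
exists f, g; split=> //; split.
  move=> i Y Y' YY'; rewrite /g; congr odflt; apply: eq_pick => v /=.
  apply: asbool_equiv_eq; split=> -[s [E [aE rE <-]]]; exists s, E; split=> // l j li.
    by rewrite rE ?YY'.
  by rewrite rE -?YY'.
move=> s E aE i; rewrite /g; case: pickP => [v /asboolP[s' [E' [aE' rE' <-]]]|/(_ (s i))] /=.
  by apply: (PU s' E' s E).
by move=> /negP; case; apply/asboolP; exists s, E.
Qed.

(** Two distinct erasures exclude the bound of one per window, so all positions from [u] to [w] are
    erased, and the window allows at most [B] of them. *)
Lemma admissible1_span (B W : nat) (E : nat -> bool) (t u w : nat) :
    (0 < B)%N -> admissible 1 B W E ->
    (t <= u)%N -> (u <= w)%N -> (w < t + W)%N -> E u -> E w ->
  (w < u + B)%N.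
Proof.
move=> B0 /(_ t) aE tu uw wt Eu Ew.
have [->|neq] := eqVneq u w; first lia.
case: aE => [[bE cE]|cE].
  have : (\sum_(u <= z < w.+1) 1 <= nerasures E W t)%N.
    rewrite /nerasures (@big_cat_nat _ _ _ u t) /=; [|lia..].
    rewrite (@big_cat_nat _ _ _ w.+1 u (t + W)) /=; [|lia..].
    apply: leq_trans (leq_addl _ _); apply: leq_trans (leq_addr _ _).
    rewrite big_nat [X in (_ <= X)%N]big_nat; apply: leq_sum => z /andP[uz zw].
    by rewrite (bE u z w).
  by rewrite sum_nat_const_nat; lia.
have : (1 + 1 <= nerasures E W t)%N; last lia.
rewrite /nerasures (@big_cat_nat _ _ _ w t) /=; [|lia..].
apply: leq_add.
  by rewrite (bigD1_seq u) /= ?Eu ?leq_addr ?iota_uniq // mem_index_iota; lia.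
by rewrite (bigD1_seq w) /= ?Ew ?leq_addr ?iota_uniq // mem_index_iota; lia.
Qed.

(** * Layout of a macro-packet and decoding after one burst *)

Lemma count_iota_periodic (a : pred nat) (P b l : nat) :
    (forall z, a (z + P)%N = a z) ->
  count a (iota 0 (b * P + l)) =
  (b * count a (iota 0 P) + count a (iota 0 l))%N.
Proof.
move=> aP; elim: b => [|b IH]; first by rewrite !mul0n.
rewrite !mulSn -!addnA iotaD count_cat -IH; congr addn.
rewrite -[(0 + P)%N]addn0 iotaDl count_map; apply: eq_count => z /=.
by rewrite add0n addnC aP.
Qed.

Lemma count_iota_interval (lo hi n : nat) :
  count (fun z => lo <= z < hi)%N (iota 0 n) = (minn n hi - lo)%N.
Proof.
elim: n => [|n IH]; first by rewrite min0n.
by rewrite -addn1 iotaD count_cat IH /=; lia.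
Qed.

(* Offsets inside a macro-packet of [P] scalars: [0, U) carries [u],
   [U, U + V) carries [v], [P - U, P) carries parities, the rest is padding. *)
Definition vpos (U V P z : nat) := (U <= z %% P < U + V)%N.
Definition qpos (U P z : nat) := (P - U <= z %% P)%N.

Lemma count_vpos (U V P b l : nat) : (U + V <= P)%N -> (l <= P)%N ->
  count (vpos U V P) (iota 0 (b * P + l)) = (b * V + (minn l (U + V) - U))%N.
Proof.
move=> UVP lP; rewrite count_iota_periodic; last by move=> z; rewrite /vpos modnDr.
have cE j : (j <= P)%N -> count (vpos U V P) (iota 0 j) = (minn j (U + V) - U)%N.
  move=> jP; rewrite -count_iota_interval; apply: eq_in_count => z.
  by rewrite mem_iota /vpos => zj; rewrite modn_small //; lia.
by rewrite !cE //; congr (_ * _ + _)%N; lia.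
Qed.

Lemma count_qpos (U P b l : nat) : (U <= P)%N -> (l <= P)%N ->
  count (qpos U P) (iota 0 (b * P + l)) = (b * U + (l - (P - U)))%N.
Proof.
move=> UP lP; rewrite count_iota_periodic; last by move=> z; rewrite /qpos modnDr.
have cE j : (j <= P)%N -> count (qpos U P) (iota 0 j) = (j - (P - U))%N.
  move=> jP; rewrite -[in RHS](minn_idPl jP) -count_iota_interval.
  apply: eq_in_count => z; rewrite mem_iota /qpos => zj.
  by rewrite modn_small //; lia.
by rewrite !cE //; congr (_ * _ + _)%N; lia.
Qed.

(* With [D = (T + 1) * P], position [z + U - D] holds the [u] sent [T]
   macro-packets before the parity at [z]. *)
Definition flat_symbol (F : fieldType) (U V P D : nat) (xi sg : nat -> F)
    (z : nat) : F :=
  if (z %% P < U + V)%N then sg z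
  else if qpos U P z then
    (if (D <= z + U)%N then sg (z + U - D)%N else 0) +
    \sum_(0 <= y < z | vpos U V P y && (z < y + D)%N) sg y / (xi z - xi y)
  else 0.
Arguments flat_symbol {F}.

Lemma flat_symbolB (F : fieldType) (U V P D : nat) (xi sg sg' : nat -> F) z :
  flat_symbol U V P D xi (fun y => sg y - sg' y) z =
  flat_symbol U V P D xi sg z - flat_symbol U V P D xi sg' z.
Proof.
rewrite /flat_symbol; case: ifP => _ //; case: ifP => _; rewrite ?subr0 //.
under eq_bigr do rewrite mulrBl.
by rewrite sumrB; case: ifP => _; ring.
Qed.

Lemma flat_symbol_causal (F : fieldType) (U V P D : nat) (xi sg sg' : nat -> F) z :
    (U <= D)%N -> (forall y, (y <= z)%N -> sg y = sg' y) ->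
  flat_symbol U V P D xi sg z = flat_symbol U V P D xi sg' z.
Proof.
move=> UD eq_sg; rewrite /flat_symbol eq_sg // [sg (_ - _)%N]eq_sg; last lia.
case: ifP => // _; case: ifP => // _; congr (_ + _).
rewrite big_nat_cond [RHS]big_nat_cond; apply: eq_bigr => y /andP[yz _].
by rewrite eq_sg //; lia.
Qed.

(* [o] starts the macro-packet to decode and [o + [x, x + L)] is the burst.  As
   everything is linear, it suffices to show that a source invisible outside the
   burst vanishes. *)
Lemma flat_decode (F : fieldType) (U V P T L o x : nat) (xi sg : nat -> F) :
    (U + V + U <= P)%N -> (P %| o)%N -> (L + U <= T.+1 * P)%N ->
    (count (vpos U V P) (iota 0 L) + count (qpos U P) (iota 0 L) <= T * U)%N ->
    (forall y z, (y < z < y + T.+1 * P)%N -> xi z != xi y) ->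
    (forall z, (z < o)%N -> sg z = 0) ->
    (forall z, (z < T.+1 * P)%N -> (z < x)%N || (x + L <= z)%N ->
       flat_symbol U V P (T.+1 * P) xi sg (o + z) = 0) ->
  forall c, (c < U + V)%N -> sg (o + c)%N = 0.
Proof.
set D := (T.+1 * P)%N => leP Po LU cnt xiP sg0 clean c cUV.
have DE : D = (T * P + P)%N by rewrite /D mulSn addnC.
have modo z : ((o + z) %% P = z %% P)%N by rewrite -modnDml (eqP Po) add0n.
have clean_sg z : (z < D)%N -> (z < x)%N || (x + L <= z)%N -> (z %% P < U + V)%N ->
    sg (o + z)%N = 0.
  by move=> zD zx zP; have := clean z zD zx; rewrite /flat_symbol modo zP.
have cP : (c %% P)%N = c by rewrite modn_small //; lia.
(* If the burst starts after the source symbols of the macro-packet, these are received in clear. *)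
have [UVx|xUV] := leqP (U + V) x.
  by apply: clean_sg; rewrite ?cP //; lia.
(* Parities before [Z] have a known [u]-part: for [z < T * P] it predates
   macro-packet [o %/ P]; otherwise it precedes the burst. *)
pose Z := (T * P + (P - U + minn x U))%N.
have ZD : (Z <= D)%N by rewrite /Z; lia.
pose A := [seq y <- iota x L | vpos U V P y].
pose S := [seq z <- iota (x + L) (Z - (x + L)) | qpos U P z].
(* Moving the burst from offset 0 to [x] adds at most [x] positions of type v or parity and spares
   [x - U] v's (truncated); the difference is made up by the [minn x U] extra parities before
   [Z]. *)
have leAS : (size A <= size S)%N.
  have cA : (count (vpos U V P) (iota 0 (x + L)) =
             count (vpos U V P) (iota 0 x) + size A)%N.
    by rewrite iotaD count_cat size_filter.
  have cS : (count (qpos U P) (iota 0 Z) <=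
             count (qpos U P) (iota 0 (x + L)) + size S)%N.
    rewrite size_filter; have [ZL|LZ] := leqP Z (x + L).
      by rewrite -(subnKC ZL) iotaD count_cat; lia.
    by rewrite -{1}(subnKC (ltnW LZ)) iotaD count_cat add0n.
  have cL (a : pred nat) : count a (iota 0 (x + L)) =
      (count a (iota 0 L) + count a (iota L x))%N.
    by rewrite addnC iotaD count_cat.
  have cx : (count (vpos U V P) (iota L x) + count (qpos U P) (iota L x) <= x)%N.
    rewrite -count_predUI [X in (_ + X)%N](_ : _ = 0)%N.
      by rewrite addn0; apply: leq_trans (count_size _ _) _; rewrite size_iota.
    apply/eqP; rewrite -leqn0 leqNgt -has_count; apply/hasPn => z _ /=.
    by rewrite /vpos /qpos; lia.
  have := @count_vpos U V P 0 x ltac:(lia) ltac:(lia).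
  have := @count_qpos U P T (P - U + minn x U) ltac:(lia) ltac:(lia).
  rewrite -/Z !mul0n !add0n; move: cS (cL (qpos U P)) (cL (vpos U V P)); rewrite cA.
  by lia.
have SP z : z \in S -> [/\ (x + L <= z)%N, (z < Z)%N, (z < D)%N & qpos U P z].
  rewrite mem_filter mem_iota => /andP[-> zI]; split=> //; lia.
have cleanv y : (y < D)%N -> vpos U V P y -> y \notin A -> sg (o + y)%N = 0.
  rewrite mem_filter mem_iota => yD yv; rewrite yv /= => yA.
  by apply: clean_sg => //; move: yv; rewrite /vpos; lia.
have q_nd z : qpos U P z -> (z %% P < U + V)%N = false.
  by rewrite /qpos; lia.
(* Symbols before [o] are zero, and for [z < D] the memory bound holds automatically. *)
have sumE z : (z < D)%N ->
    \sum_(0 <= y < o + z | vpos U V P y && (o + z < y + D)%N)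
       sg y / (xi (o + z)%N - xi y) =
    \sum_(0 <= y < z | vpos U V P y) sg (o + y)%N / (xi (o + z)%N - xi (o + y)%N).
  move=> zD; rewrite (@big_cat_nat _ _ _ o) /=; [|lia..].
  rewrite big_nat_cond big1 ?add0r; last first.
    by move=> y /andP[yo _]; rewrite sg0 ?mul0r //; lia.
  rewrite -{1}[o]add0n big_addn addKn big_nat_cond [RHS]big_nat_cond.
  apply: eq_big => y; last by rewrite addnC.
  by rewrite addnC /vpos modo; lia.
have xi_inj y z : (y < z + D)%N -> (z < y + D)%N ->
    xi (o + y)%N = xi (o + z)%N -> y = z.
  move=> yz zy xyz; case: (ltngtP y z) => // lt.
    by have /eqP[] := xiP (o + y)%N (o + z)%N ltac:(lia).
  by have /eqP[] := xiP (o + z)%N (o + y)%N ltac:(lia).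
have A0 : {in A, forall y, sg (o + y)%N = 0}.
  pose x' (y : nat) := xi (o + y)%N.
  apply: (@cauchy_kernel F _ A x' (fun y => sg (o + y)%N) [seq xi (o + z)%N | z <- S]).
  - rewrite map_inj_in_uniq ?filter_uniq ?iota_uniq // => y z.
    by rewrite !mem_filter !mem_iota => yA zA; apply: xi_inj; lia.
  - rewrite map_inj_in_uniq ?filter_uniq ?iota_uniq // => y z.
    by rewrite !mem_filter !mem_iota => yS zS; apply: xi_inj; lia.
  - by rewrite size_map.
  - move=> y w yA /mapP[z /SP[xz zZ zD zq] ->]; apply: xiP.
    by move: yA; rewrite mem_filter mem_iota; lia.
  move=> w /mapP[z /SP[xz zZ zD zq] ->].
  have := clean z zD; rewrite xz orbT => /(_ isT).
  have qoz : qpos U P (o + z) by rewrite /qpos modo.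
  rewrite /flat_symbol q_nd // qoz sumE //.
  have -> : (if (D <= o + z + U)%N then sg (o + z + U - D)%N else 0) = 0.
    case: ifP => // DU; have [lto|geo] := ltnP (o + z + U - D) o; first exact: sg0.
    rewrite (_ : o + z + U - D = o + (z + U - D))%N; last lia.
    have ? : (z + U - D < minn x U)%N by move: zZ; rewrite /Z; lia.
    by apply: clean_sg; rewrite ?modn_small; lia.
  rewrite add0r => sum0; rewrite -[RHS]sum0.
  (* Cutting the sum at [x] and [x + L] leaves only the erased v's. *)
  rewrite (@big_cat_nat _ _ _ (x + L) 0 z) /=; [|lia..].
  rewrite [X in _ = _ + X]big_nat_cond [X in _ = _ + X]big1 ?addr0; last first.
    move=> y /andP[yI yv]; rewrite cleanv ?mul0r //; first lia.
    by rewrite mem_filter mem_iota; lia.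
  rewrite (@big_cat_nat _ _ _ x 0 (x + L)) /=; [|lia..].
  rewrite [X in _ = X + _]big_nat_cond [X in _ = X + _]big1 ?add0r; last first.
    move=> y /andP[yI yv]; rewrite cleanv ?mul0r //; first lia.
    by rewrite mem_filter mem_iota; lia.
  by rewrite big_filter /index_iota addKn.
have v0 y : (y < D)%N -> vpos U V P y -> sg (o + y)%N = 0.
  by move=> yD yv; have [/A0 //|yA] := boolP (y \in A); apply: cleanv.
have [Uc|cU] := leqP U c; first by apply: v0; rewrite /vpos ?cP; lia.
have [cx|xc] := ltnP c x; first by apply: clean_sg; rewrite ?cP; lia.
(* The parity that repeats [sg (o + c)]. It lies after the burst because [x <= c] and [L + U <= D],
   and its Cauchy part is now zero. *)
pose z := (T * P + (P - U + c))%N.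
have zP : (z %% P = P - U + c)%N by rewrite /z modnMDl modn_small //; lia.
have zD : (z < D)%N by rewrite /z; lia.
have := clean z zD; have -> : (z < x)%N || (x + L <= z)%N by rewrite /z; lia.
move=> /(_ isT); have zq : qpos U P z by rewrite /qpos zP; lia.
have qoz : qpos U P (o + z) by rewrite /qpos modo.
rewrite /flat_symbol q_nd // qoz sumE // big_nat_cond big1 ?addr0; last first.
  by move=> y /andP[yI yv]; rewrite v0 ?mul0r //; lia.
rewrite ifT; last by rewrite /z; lia.
by rewrite (_ : o + z + U - D = o + c)%N // /z; lia.
Qed.

(** * From scalar layouts to streaming codes *)

Definition flatten_stream (R : nzRingType) (k P : nat) (s : nat -> 'rV[R]_k)
    (z : nat) : R :=
  if insub (z %% P)%N is Some c then s (z %/ P)%N 0 c else 0.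
Arguments flatten_stream {R k}.

(** Supplies Cauchy nodes for an unbounded stream over a fixed field: nodes may repeat, but only at
    distance [D] or more. *)
Lemma Fp_natr_mod_neq (p D y z : nat) : prime p -> (D <= p)%N ->
  (y < z < y + D)%N -> ((z %% D)%:R : 'F_p) != (y %% D)%:R.
Proof.
move=> pp Dp /andP[yz zy]; apply/eqP => /(congr1 val) /=.
have D0 : (0 < D)%N by lia.
have ltp w : (w %% D < p)%N by rewrite (leq_trans (ltn_pmod _ D0)).
rewrite !val_Fp_nat // !(modn_small (ltp _)) => /eqP.
by rewrite eqn_mod_dvd ?(ltnW yz) // => /dvdn_leq; lia.
Qed.

(** Scaling by [n] turns a burst of [B] channel uses into one of [B * n] scalars, and linearity
    replaces two indistinguishable sources by their difference, to which [flat_decode] applies. *)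
Lemma layout_achievable (M B T W U V n : nat) :
    (0 < M)%N -> (0 < B)%N -> (M * (T + 1) <= W)%N -> (0 < n)%N ->
    (U + V + U <= M * n)%N -> (B * n + U <= T.+1 * (M * n))%N ->
    (count (vpos U V (M * n)) (iota 0 (B * n)) +
     count (qpos U (M * n)) (iota 0 (B * n)) <= T * U)%N ->
  achievable M T 1 B W ((U + V)%:R / (M * n)%:R).
Proof.
move=> M0 B0 MW n0; set P := (M * n)%N; set D := (T.+1 * P)%N => leP LU cnt.
have P0 : (0 < P)%N by rewrite muln_gt0 M0.
have [p Dp pp] := prime_above D.
pose xi z : 'F_p := (z %% D)%:R.
exists 'F_p, (U + V)%N, n; split=> //; split=> //.
pose f : encoder 'F_p (U + V) n M := fun i j s =>
  \row_(e < n) flat_symbol U V P D xi (flatten_stream P s) ((i * M + j) * n + e)%N.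
apply: (@streaming_code_of_unique _ _ _ _ _ _ _ _ f).
  move=> i j s s' ss'; apply/rowP => e; rewrite !mxE.
  apply: flat_symbol_causal => [|y yz]; first by rewrite /D mulSn; lia.
  rewrite /flatten_stream ss' // -ltnS ltn_divLR //.
  apply: leq_ltn_trans yz _; rewrite /P mulnA.
  have jM := ltn_ord j; have en := ltn_ord e.
  have : ((i * M + j).+1 * n <= i.+1 * M * n)%N by rewrite leq_mul2r mulSn; lia.
  by rewrite mulSn; lia.
move=> s s' E i aE ss' fE.
pose sg z := flatten_stream P s z - flatten_stream P s' z.
(* First erasure up to the deadline; if there is none, [find] returns [T.+1 * M] and every use
   counts as preceding the burst. *)
pose x0 := find (fun a => E (i * M + a)%N) (iota 0 (T.+1 * M)).
have clean_use a : (a < T.+1 * M)%N -> (a < x0)%N || (x0 + B <= a)%N ->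
    ~~ E (i * M + a)%N.
  move=> aTM; case/orP => [ax|xa].
    by have := before_find 0%N ax; rewrite nth_iota ?size_iota // add0n => ->.
  have hasE : has (fun a => E (i * M + a)%N) (iota 0 (T.+1 * M)).
    by rewrite has_find size_iota -/x0; lia.
  have Ex : E (i * M + x0)%N.
    by have := nth_find 0%N hasE; rewrite nth_iota -/x0 ?add0n //; lia.
  apply/negP => Ea.
  have := @admissible1_span B W E (i * M) _ _ B0 aE _ _ _ Ex Ea.
  have : (T.+1 * M <= W)%N by rewrite -addn1 mulnC.
  by lia.
apply/rowP => c.
have : sg (i * P + c)%N = 0.
  apply: (@flat_decode _ U V P T (B * n) (i * P) (x0 * n) xi) => //.
  - by rewrite dvdn_mull.
  - by move=> y z yz; apply: Fp_natr_mod_neq => //; apply: ltnW.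
  - by move=> z ziP; rewrite /sg /flatten_stream ss' ?subrr // ltn_divLR.
  move=> z zD zx; rewrite flat_symbolB.
  set a := (z %/ n)%N.
  have aTM : (a < T.+1 * M)%N by rewrite ltn_divLR // -mulnA.
  have aE' : ~~ E (i * M + a)%N.
    apply: clean_use => //; case/orP: zx => zx; apply/orP.
      by left; rewrite ltn_divLR.
    by right; rewrite leq_divRL // mulnDl.
  have chanE : (i * M + a = (i + a %/ M) * M + a %% M)%N.
    by rewrite mulnDl -addnA -divn_eq.
  have aM : (a %% M < M)%N by rewrite ltn_pmod.
  have := fE (i + a %/ M)%N (Ordinal aM).
  rewrite /chan_idx /= -chanE => /(_ _ aE').
  have aT : (i + a %/ M <= i + T)%N by rewrite leq_add2l -ltnS ltn_divLR.
  move=> /(_ aT) /rowP /(_ (Ordinal (ltn_pmod z n0))); rewrite !mxE /= -chanE.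
  rewrite mulnDl -addnA -divn_eq -mulnA => ->.
  by rewrite subrr.
have cP : (c < P)%N by have := ltn_ord c; lia.
rewrite /sg /flatten_stream divnMDl // modnMDl (divn_small cP) (modn_small cP) addn0.
by rewrite valK => /eqP; rewrite subr_eq0 => /eqP.
Qed.

(** * Converse bounds *)

Lemma admissible_burst (N B W a len : nat) : (len <= B)%N ->
  admissible N B W (fun u => a <= u < a + len)%N.
Proof.
move=> lenB t; left; split; first by move=> u v w; lia.
have -> : nerasures (fun u => a <= u < a + len)%N W t =
          (minn (t + W) (a + len) - maxn t a)%N.
  elim: W => [|W IH]; first by rewrite /nerasures addn0 big_geq //; lia.
  by rewrite /nerasures addnS big_nat_recr /=; [move: IH; rewrite /nerasures => ->|]; lia.
lia.
Qed.

Lemma leq_card_vectors (F : finFieldType) (k n : nat) (A B : finType)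
    (phi : {ffun A -> 'rV[F]_k} -> {ffun B -> 'rV[F]_n}) :
  injective phi -> (k * #|A| <= n * #|B|)%N.
Proof.
move=> /leq_card; rewrite !card_ffun !card_mx !mul1n -!expnM.
by rewrite leq_exp2l // card_finNzRing_gt1.
Qed.

Definition channel_use (F : finFieldType) (k n M : nat) (f : encoder F k n M)
    (M0 : (0 < M)%N) (s : nat -> 'rV[F]_k) (c : nat) : 'rV[F]_n :=
  f (c %/ M)%N (Ordinal (ltn_pmod c M0)) s.
Arguments channel_use {F k n M}.

Lemma channel_useE (F : finFieldType) (k n M : nat) (f : encoder F k n M)
    (M0 : (0 < M)%N) (s : nat -> 'rV[F]_k) (l : nat) (j : 'I_M) :
  channel_use f M0 s (chan_idx l j) = f l j s.
Proof.
rewrite /channel_use /chan_idx; set j' := Ordinal _.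
have -> : j' = j by apply: val_inj; rewrite /= modnMDl modn_small.
by rewrite divnMDl // divn_small // addn0.
Qed.

Lemma decoder_unique (F : finFieldType) (k n M T N B W : nat)
    (f : encoder F k n M) (g : decoder F k n M) (M0 : (0 < M)%N)
    (s s' : nat -> 'rV[F]_k) (E : nat -> bool) (i : nat) :
    causal_dec T g ->
    (forall s E, admissible N B W E -> forall i, g i (received f s E) = s i) ->
    admissible N B W E ->
    (forall c, (c < (i + T).+1 * M)%N -> ~~ E c ->
       channel_use f M0 s c = channel_use f M0 s' c) ->
  s i = s' i.
Proof.
move=> cg fgK aE fE; rewrite -(fgK s E) // -(fgK s' E) //; apply: cg => l j li.
rewrite /received; case: ifP => // nE; rewrite -!(channel_useE _ _ _ _ f M0) fE ?nE //.
rewrite /chan_idx; have : (l.+1 * M <= (i + T).+1 * M)%N by rewrite leq_mul2r; lia.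
by have := ltn_ord j; rewrite mulSn; lia.
Qed.

(** Only [s 0] varies, and the uses left by a burst at time 0 must determine it. Truncated
    subtraction forces [k = 0] when the burst reaches the deadline. *)
Lemma single_burst_converse (F : finFieldType) (k n M T N B W : nat) :
    (0 < M)%N -> streaming_code F k n M T N B W ->
  (k <= n * (T.+1 * M - B))%N.
Proof.
move=> M0 [f [g [_ [cg fgK]]]].
pose s (a : {ffun 'I_1 -> 'rV[F]_k}) (l : nat) : 'rV[F]_k :=
  if l == 0%N then a 0 else 0.
pose phi a := [ffun e : 'I_(T.+1 * M - B) => channel_use f M0 (s a) (B + e)%N].
have := @leq_card_vectors F k n _ _ phi; rewrite !card_ord muln1; apply.
move=> a a' /ffunP eq_phi; apply/ffunP => i; rewrite !ord1.
apply: (@decoder_unique F k n M T N B W f g M0 (s a) (s a') _ 0 cg fgK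
          (admissible_burst N B W 0 B (leqnn B))).
rewrite add0n => c cT; rewrite leq0n /= -leqNgt => Bc.
have cB : (c - B < T.+1 * M - B)%N by lia.
by have := eq_phi (Ordinal cB); rewrite !ffunE /= subnKC.
Qed.

(** Letting [m] grow absorbs the [z] extra periods; [m = z * y + 1] is large enough. *)
Lemma leq_of_leq_affine (x y z : nat) :
  (forall m, m * x <= (m + z) * y)%N -> (x <= y)%N.
Proof.
by move=> /(_ (z * y).+1); rewrite mulnDl; move: (z * y)%N => w; nia.
Qed.

(** Since [be <= de * M], each burst stays in the first [de] macro-packets of its period, and the
    [T] clean ones after it separate it from the next. *)
Lemma periodic_burst_converse (F : finFieldType) (k n M T N B W be de : nat) :
    (0 < M)%N -> (0 < T + de)%N -> (be <= B)%N -> (be <= de * M)%N ->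
    streaming_code F k n M T N B W ->
  (k * (T + de) <= n * ((T + de) * M - be))%N.
Proof.
move=> M0 Pi0 beB bede [f [g [cf [cg fgK]]]].
set Pi := (T + de)%N in Pi0 *.
have PM0 : (0 < Pi * M)%N by rewrite muln_gt0 Pi0.
(* Sources fill [L] periods; as [Pi] is positive, [T] more periods contain the last deadline. *)
apply: (@leq_of_leq_affine _ _ T) => L.
pose s (a : {ffun 'I_(L * Pi) -> 'rV[F]_k}) (l : nat) :=
  if insub l is Some o then a o else 0.
pose phi a := [ffun me : 'I_(L + T) * 'I_(Pi * M - be) =>
  channel_use f M0 (s a) (me.1 * (Pi * M) + (be + me.2))%N].
have := @leq_card_vectors F k n _ _ phi; rewrite card_prod !card_ord.
rewrite mulnCA [(n * (_ * _))%N]mulnCA; apply.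
move=> a a' /ffunP eq_phi.
have seen c : (c < (L + T) * (Pi * M))%N -> (be <= c %% (Pi * M))%N ->
    channel_use f M0 (s a) c = channel_use f M0 (s a') c.
  move=> cL bec; have qL : (c %/ (Pi * M) < L + T)%N by rewrite ltn_divLR.
  have rP : (c %% (Pi * M) - be < Pi * M - be)%N.
    by rewrite ltn_sub2r ?ltn_pmod // (leq_ltn_trans bec) // ltn_pmod.
  have := eq_phi (Ordinal qL, Ordinal rP).
  by rewrite !ffunE /= subnKC // -divn_eq.
have eq_s i : (i < L * Pi)%N -> s a i = s a' i.
  elim/ltn_ind: i => i IH iL.
  (* Up to the deadline of [s i], only the burst opening period [m] is unknown. *)
  set m := ((i + T) %/ Pi)%N.
  apply: (@decoder_unique F k n M T N B W f g M0 _ _ _ i cg fgK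
            (admissible_burst N B W (m * (Pi * M)) be beB)).
  move=> c cT nE; have [ci|ic] := ltnP (c %/ M) i.
    by apply: cf => l lc; apply: IH; lia.
  have cTl : (c %/ M < (i + T).+1)%N by rewrite ltn_divLR.
  apply: seen.
    apply: leq_trans cT _; rewrite mulnA leq_mul2r mulnDl.
    by rewrite orbC -addSn leq_add // leq_pmulr.
  rewrite leqNgt; apply/negP => rbe.
  have qE : (c %/ (Pi * M) = c %/ M %/ Pi)%N by rewrite mulnC divnMA.
  have qm : (c %/ (Pi * M) <= m)%N by rewrite qE leq_div2r; lia.
  have [eqm|ltm] := eqVneq (c %/ (Pi * M))%N m.
    by move: nE; rewrite (divn_eq c (Pi * M)) eqm leq_addr /= ltn_add2l rbe.
  (* A burst position not before macro-packet [i] puts [i] among the first [de] macro-packets of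
     that period or earlier, so [i + T] precedes the next period. *)
  have : (m <= c %/ (Pi * M))%N; last lia.
  rewrite -ltnS ltn_divLR // mulSn.
  have rde : (c %/ M < c %/ (Pi * M) * Pi + de)%N.
    rewrite ltn_divLR // mulnDl -mulnA {1}(divn_eq c (Pi * M)) ltn_add2l.
    exact: leq_trans rbe bede.
  by move: ic rde; rewrite /Pi; lia.
apply/ffunP => o; have := eq_s o (ltn_ord o).
by rewrite /s valK.
Qed.

(** * Capacity in the four cases *)

Lemma ler_natdiv (a b c d : nat) : (0 < b)%N -> (0 < d)%N ->
  ((a%:R / b%:R : rat) <= c%:R / d%:R) = (a * d <= c * b)%N.
Proof.
move=> b0 d0; rewrite ler_pdivrMr ?ltr0n // mulrAC ler_pdivlMr ?ltr0n //.
by rewrite -!natrM ler_nat.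
Qed.

Lemma eqr_natdiv (a b c d : nat) : (0 < b)%N -> (0 < d)%N -> (a * d = c * b)%N ->
  (a%:R / b%:R : rat) = c%:R / d%:R.
Proof.
by move=> b0 d0 e; apply/eqP; rewrite eq_le !ler_natdiv // e leqnn.
Qed.

Lemma is_capacity_natdiv (M T N B W a d : nat) : (0 < M)%N -> (0 < d)%N ->
    achievable M T N B W (a%:R / d%:R) ->
    (forall F k n, (0 < n)%N -> streaming_code F k n M T N B W ->
       (k * d <= a * (M * n))%N) ->
  is_capacity M T N B W (a%:R / d%:R).
Proof.
move=> M0 d0 ach conv; split=> // _ [F [k [n [n0 [-> code]]]]].
by rewrite ler_natdiv ?muln_gt0 ?M0 //; apply: conv code.
Qed.

(* B = b*M + B' with b = B %/ M and B' = B %% M. *)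
Theorem theorem3 (M B T W : nat) :
  (1 <= M)%N -> (1 <= B)%N -> (M * (T + 1) <= W)%N ->
  let b := (B %/ M)%N in
  let B' := (B %% M)%N in
  [/\ ((0 < T)%N -> (b <= T)%N ->
         (B'%:R : rat) <= (b%:R / (T + b)%:R) * M%:R ->
         is_capacity M T 1 B W (T%:R / (T + b)%:R)),
      ((b < T)%N ->
         (B'%:R : rat) > (b%:R / (T + b)%:R) * M%:R ->
         is_capacity M T 1 B W
           (((M * (T + b + 1))%:R - B%:R) / (M * (T + b + 1))%:R)),
      (T = b ->
         (B'%:R : rat) > M%:R / 2 ->
         is_capacity M T 1 B W ((M%:R - B'%:R) / M%:R))
    & ((T < b)%N -> is_capacity M T 1 B W 0)].
Proof.
move=> M0 B0 MW b B'.
have BE : B = (b * M + B')%N := divn_eq B M.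
have B'M : (B' < M)%N by rewrite ltn_pmod.
have b_mulE (t : nat) : (0 < t)%N ->
    ((B'%:R : rat) <= b%:R / t%:R * M%:R) = (B' * t <= b * M)%N.
  by move=> t0; rewrite mulrAC ler_pdivlMr ?ltr0n // -!natrM ler_nat.
clearbody b B'; split.
- move=> T0 bT; rewrite b_mulE ?addn_gt0 ?T0 // => B'le.
  apply: is_capacity_natdiv => //; first lia.
    (* Layout: [n = T + b], [U = b * M], [V = (T - b) * M], without padding. As [B' * n <= U], the
       last partial macro-packet of a burst from offset 0 hits only u's. *)
    have -> : (T%:R / (T + b)%:R : rat) =
              (b * M + (T - b) * M)%:R / (M * (T + b))%:R.
      by apply: eqr_natdiv; [lia|lia|rewrite -mulnDl subnKC //; lia].
    have LE : (B * (T + b) = b * (M * (T + b)) + B' * (T + b))%N.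
      by rewrite BE; ring.
    have PE : (M * (T + b) = b * M + (T - b) * M + b * M)%N.
      by rewrite -!mulnDl subnKC // mulnC.
    have bP : (b * (M * (T + b)) <= T * (M * (T + b)))%N by rewrite leq_mul2r bT orbT.
    have bTE : (b * ((T - b) * M) + b * (b * M) = T * (b * M))%N.
      by rewrite -mulnDr -mulnDl subnK // mulnCA.
    apply: layout_achievable => //; rewrite ?LE ?count_vpos ?count_qpos //; try lia.
  move=> F k n n0 /(@periodic_burst_converse F k n M T 1 B W (b * M) b M0).
  move=> /(_ ltac:(lia) ltac:(lia) (leqnn _)).
  by rewrite mulnDl addnK; lia.
- move=> bT; rewrite ltNge b_mulE; last lia.
  rewrite -ltnNge => B'gt.
  have BP : (B + B <= M * (T + b + 1))%N.
    have : (M * (b + 1 + b + 1) <= M * (T + b + 1))%N by rewrite leq_mul2l; lia.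
    by rewrite BE; lia.
  have P0 : (0 < M * (T + b + 1))%N by lia.
  rewrite -natrB; last lia.
  apply: is_capacity_natdiv => //.
    (* Layout: [n = T + b + 1], [U = B], the rest v's. Here [B' * n > U], so a burst from offset 0
       covers [b + 1] full blocks of u's and [B * n - (b + 1) * B = T * U] other positions. *)
    rewrite (_ : _ - B = B + (M * (T + b + 1) - B - B))%N; last lia.
    have LE : (B * (T + b + 1) = b * (M * (T + b + 1)) + B' * (T + b + 1))%N.
      by rewrite BE; ring.
    have lP : (B' * (T + b + 1) <= M * (T + b + 1))%N by rewrite leq_mul2r ltnW ?orbT.
    have bP : (b.+1 * (M * (T + b + 1)) <= T * (M * (T + b + 1)))%N.
      by rewrite leq_mul2r bT orbT.
    apply: layout_achievable => //; first lia.
    - lia.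
    - by rewrite mulSn; lia.
    rewrite LE count_vpos ?count_qpos //; try lia.
    have -> : (b * (M * (T + b + 1) - B - B) = b * (M * (T + b + 1)) - b * B - b * B)%N.
      by rewrite !mulnBr.
    have bBP : (b * B + b * B <= b * (M * (T + b + 1)))%N by rewrite -mulnDr leq_mul2l BP orbT.
    have TE : (B * (T + b + 1) = T * B + b * B + B)%N by ring.
    by lia.
  move=> F k n n0 /(@periodic_burst_converse F k n M T 1 B W B b.+1 M0).
  move=> /(_ ltac:(lia) (leqnn _) ltac:(lia)).
  have -> : (T + b.+1 = T + b + 1)%N by lia.
  rewrite [((T + b + 1) * M)%N]mulnC; move: (T + b + 1)%N => t kt.
  by rewrite mulnCA [((_ - _) * _)%N]mulnCA leq_mul2l [((_ - _) * _)%N]mulnC kt orbT.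
- move=> TE; rewrite ltr_pdivrMr ?ltr0n // -natrM ltr_nat => MB'.
  rewrite -natrB; last lia.
  apply: is_capacity_natdiv => //.
    (* Pure repetition at delay [T]: [n = 1], [U = M - B'], [V = 0], with padding [2 * B' - M]. *)
    have -> : ((M - B')%:R / M%:R : rat) = (M - B' + 0)%:R / (M * 1)%:R.
      by rewrite addn0 muln1.
    apply: layout_achievable => //; rewrite ?muln1 ?BE ?count_vpos ?count_qpos //; lia.
  move=> F k n n0 /(@single_burst_converse F k n M T 1 B W M0).
  rewrite (_ : T.+1 * M - B = M - B')%N; last by rewrite BE TE mulSn; lia.
  by move=> /(leq_mul (leqnn M)); lia.
- move=> Tb; rewrite (_ : 0 = 0%:R / 1%:R :> rat); last by rewrite mul0r.
  apply: is_capacity_natdiv => //.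
    (* Rate 0 comes from empty source symbols, [k = 0]. *)
    exists 'F_2, 0%N, 1%N; split=> //; split; first by rewrite !mul0r.
    exists (fun _ _ _ => 0), (fun _ _ => 0); split=> //; split=> // s E _ i.
    by rewrite [s i]thinmx0.
  move=> F k n n0 /(@single_burst_converse F k n M T 1 B W M0).
  have : (T.+1 * M <= b * M)%N by rewrite leq_mul2r Tb orbT.
  by move=> TbM; rewrite (_ : T.+1 * M - B = 0)%N ?muln0; lia.
Qed.
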